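(* Let $K\subset L$ be a field extension. Let $A$ and $B$ be two $n$-dimensional $K$-subspaces of $L$ with $1\notin B$ and $n>1$. Assume further that one of the following conditions holds: (1) $B\cap M=\{0\}$ for every finite-dimensional intermediate field $K\subset M\subsetneq L$, and either $n\leq 5$ or every algebraic element of $L$ is separable over $K$; (2) $n=p(K,L)$ and $A$ is not a linear translate of any nontrivial intermediate field $K\subset M\subsetneq L$; (3) $A$ is a Sidon subspace. Then $A$ is matched to $B$.
   Context: For $n$-dimensional $K$-subspaces $A,B$ of $L$, an ordered basis $\{a_1,\ldots,a_n\}$ of $A$ is matched to an ordered basis $\{b_1,\ldots,b_n\}$ of $B$ if $a_i^{-1}A\cap B\subset\langle b_1,\ldots,b_{i-1},b_{i+1},\ldots,b_n\rangle$ for each $1\le i\le n$ (angle brackets denote $K$-span). $A$ is matched to $B$ if every ordered basis of $A$ can be matched to some ordered basis of $B$. $p(K,L)$ denotes the smallest degree $[M:K]$ of an intermediate field $K\subsetneq M\subset L$ ($p(K,L)=\infty$ if there is none of finite degree, e.g. purely transcendental). A linear translate of an intermediate field $M$ is a $K$-subspace of the form $lM$ with $l\in L^*$. A $K$-subspace $A$ of $L$ is a Sidon subspace if $\dim_K(A\cap xA)\le 1$ for all $x\in L\setminus K$. *)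

(* Defs.v *)
(* The field extension K ⊂ L is modelled as a subfield K
   (a predicate on L closed under the field operations) of a field L. *)
From mathcomp Require Import all_boot all_algebra all_field.
Set Implicit Arguments. Unset Strict Implicit. Unset Printing Implicit Defensive.
Import GRing.Theory.
Local Open Scope ring_scope.

Section Defs.
Variable L : fieldType.

Definition is_subfield (K : L -> Prop) : Prop :=
  K 0 /\ K 1 /\ (forall x y, K x -> K y -> K (x - y)) /\
  (forall x y, K x -> K y -> K (x * y)) /\ (forall x, K x -> K x^-1).

Definition intermediate_field (K M : L -> Prop) : Prop :=
  is_subfield M /\ (forall x, K x -> M x).

Definition is_subspace (K A : L -> Prop) : Prop :=
  A 0 /\ (forall x y, A x -> A y -> A (x + y)) /\
  (forall c x, K c -> A x -> A (c * x)).

Definition linindep (K : L -> Prop) (n : nat) (v : 'I_n -> L) : Prop :=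
  forall c : 'I_n -> L, (forall i, K (c i)) ->
    \sum_(i < n) c i * v i = 0 -> forall i, c i = 0.

Definition span_of (K : L -> Prop) (n : nat) (P : pred 'I_n) (v : 'I_n -> L)
  (x : L) : Prop :=
  exists c : 'I_n -> L, (forall i, K (c i)) /\ x = \sum_(j < n | P j) c j * v j.

Definition is_basis (K A : L -> Prop) (n : nat) (v : 'I_n -> L) : Prop :=
  linindep K v /\ (forall x, A x <-> span_of K predT v x).

Definition dim_subspace (K A : L -> Prop) (n : nat) : Prop :=
  is_subspace K A /\ exists v : 'I_n -> L, is_basis K A v.

Definition dim_le (K S : L -> Prop) (m : nat) : Prop :=
  forall v : 'I_m.+1 -> L, (forall i, S (v i)) -> ~ linindep K v.

Definition matched_bases (K A B : L -> Prop) (n : nat) (a b : 'I_n -> L) : Prop :=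
  forall i : 'I_n, forall x,
    (exists y, A y /\ x = (a i)^-1 * y) -> B x -> span_of K (predC1 i) b x.

Definition matched (K A B : L -> Prop) (n : nat) : Prop :=
  forall a : 'I_n -> L, is_basis K A a ->
    exists b : 'I_n -> L, is_basis K B b /\ matched_bases K A B a b.

(* p(K,L) = n  (n a natural number, so in particular p(K,L) < oo) :
   n is the smallest degree [M:K] of an intermediate field K ⊊ M ⊂ L *)
Definition p_eq (K : L -> Prop) (n : nat) : Prop :=
  (exists M, intermediate_field K M /\ (exists x, M x /\ ~ K x) /\
             dim_subspace K M n) /\
  (forall M m, intermediate_field K M -> (exists x, M x /\ ~ K x) ->
               dim_subspace K M m -> (n <= m)%N).

Definition translate_of_proper_intermediate (K A : L -> Prop) : Prop :=
  exists (l : L) (M : L -> Prop),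
    l != 0 /\ intermediate_field K M /\ (exists x, M x /\ ~ K x) /\
    (exists x, ~ M x) /\ (forall x, A x <-> exists m, M m /\ x = l * m).

Definition sidon (K A : L -> Prop) : Prop :=
  forall x, ~ K x ->
    dim_le K (fun y => A y /\ exists z, A z /\ y = x * z) 1.

Definition poly_over (K : L -> Prop) (p : {poly L}) : Prop :=
  forall i, K p`_i.

Definition algebraic_over (K : L -> Prop) (x : L) : Prop :=
  exists p : {poly L}, p != 0 /\ poly_over K p /\ root p x.

Definition is_minpoly (K : L -> Prop) (x : L) (p : {poly L}) : Prop :=
  p \is monic /\ poly_over K p /\ root p x /\
  forall q : {poly L}, q != 0 -> poly_over K q -> root q x -> (size p <= size q)%N.

Definition separable_over (K : L -> Prop) (x : L) : Prop :=
  forall p, is_minpoly K x p -> separable_poly p.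

End Defs.

(* Main.v *)
(* If an ordered basis (a_i) of A cannot be matched, then Rado's theorem on
   independent transversals, applied to the annihilators of the spaces
   a_i^-1 A ∩ B in the dual of B, yields a nonempty set J and a subspace Y of B
   with a_i Y in A for i in J and |J| + dim Y > n.  Thus S = <a_i : i in J> and
   T = K + Y satisfy S T in A and dim S + dim T >= dim A + 2.  The Dyson
   transform (S, T) |-> (S + e T, T ∩ e^-1 S), with e in S, keeps ST in A, the
   sum of the dimensions and 1 in T, and lowers dim T until S T = S.  This gives
   x <> 0 and d = c + u in K + B outside K such that x K[d] lies in A.
   Hence M = K[d] is a field with [M : K] <= n, and it contains u in B: under
   (1) M = L; under (2) A = x M; under (3) x d and x d^2 both lie in A ∩ d A.
   Finally A = L is impossible, as it forces B = L, which contains 1. *)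
Require Import Defs.
From mathcomp Require Import all_boot all_algebra all_field.
From mathcomp Require Import boolp.
From HB Require Import structures.
Set Implicit Arguments. Unset Strict Implicit. Unset Printing Implicit Defensive.
Import GRing.Theory.
Local Open Scope ring_scope.

(** * Linear predicates as row spaces, and Rado's theorem *)

(** Choose [M] of maximal rank among matrices whose row space satisfies [P]; adjoining any [v] with
    [P v] keeps this property, so maximality puts [v] in [M]. *)
Lemma linear_pred_rowspace (F : fieldType) (n : nat) (P : 'rV[F]_n -> Prop) :
  P 0 -> (forall c u v, P u -> P v -> P (c *: u + v)) ->
  exists M : 'M[F]_n, forall v, P v <-> (v <= M)%MS.
Proof.
move=> P0 Plin.
pose good (M : 'M[F]_n) := forall v, (v <= M)%MS -> P v.
have [M gM maxM] : exists2 M, good M & forall M', good M' -> (\rank M' <= \rank M)%N.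
  pose ranks r := `[< exists2 M, good M & \rank M = r >].
  have ex : exists r, ranks r.
    by exists 0; apply/asboolP; exists 0; rewrite ?mxrank0 // => v;
      rewrite submx0 => /eqP->.
  have ub r : ranks r -> (r <= n)%N by case/asboolP=> M _ <-; exact: rank_leq_row.
  case: (ex_maxnP ex ub) => r /asboolP [M gM rM] maxr.
  by exists M => // M' gM'; rewrite rM; apply: maxr; apply/asboolP; exists M'.
exists M => v; split; last exact: gM.
move=> Pv.
have gMv : good (M + v)%MS.
  move=> w /sub_addsmxP [[u1 u2] /= ->].
  have [c ->] : exists c : F, u2 = c%:M by exists (u2 0 0); rewrite [LHS]mx11_scalar.
  rewrite mul_scalar_mx addrC; apply: Plin => //; apply: gM; exact: submxMl.
have /mxrank_leqif_sup [_ eqr] := addsmxSl M v.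
have : (M + v <= M)%MS by rewrite -eqr eqn_leq mxrankS ?addsmxSl //=; apply: maxM.
exact: submx_trans (addsmxSr M v).
Qed.

(* If a space [E i] of rank at least 2 is split as [H1 + H2] and Hall's
   condition failed for both replacements, with witnesses [J1] and [J2], then
   submodularity of the rank would make it fail for [E] at
   [i |: J1 :|: J2] or [J1 :&: J2]. *)
Lemma rado_rowspaces (F : fieldType) (I : finType) (n : nat) (E : I -> 'M[F]_n) :
  (forall J : {set I}, (#|J| <= \rank (\sum_(i in J) E i)%MS)%N) ->
  exists phi : I -> 'rV[F]_n,
    (forall i, (phi i <= E i)%MS) /\ (#|I| <= \rank (\sum_i <<phi i>>)%MS)%N.
Proof.
have [m] := ubnP (\sum_i \rank (E i))%N.
elim: m E => // m IH E ltm hall.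
(* Induction on the total rank. If all ranks are at most 1, a nonzero row spans each nonzero [E i],
   and Hall's condition for the full index set is the claim. *)
have [/existsP [i0 ge2]|] := boolP [exists i, (1 < \rank (E i))%N]; last first.
  rewrite negb_exists => /forallP le1.
  exists (fun i => nz_row (E i)); split=> [i|]; first exact: nz_row_sub.
  have /= := hall [set: I]; rewrite cardsT => /leq_trans; apply.
  rewrite (eq_bigl xpredT) => [|i]; last by rewrite inE.
  apply/mxrankS/sumsmxS => i _; rewrite genmxE.
  have /mxrank_leqif_sup [_ <-] := nz_row_sub (E i).
  have := le1 i; rewrite -leqNgt => le1i.
  rewrite eqn_leq mxrankS ?nz_row_sub //= rank_rV nz_row_eq0.
  have [->|nz] := eqVneq (E i) 0; first by rewrite mxrank0.
  by [].
pose v := nz_row (E i0).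
have vn0 : v != 0 by rewrite nz_row_eq0 -mxrank_eq0; case: (\rank _) ge2.
have vE : (v <= E i0)%MS := nz_row_sub _.
pose H1 : 'M_n := <<v>>%MS; pose H2 : 'M_n := (E i0 :\: v)%MS.
have H1E : (H1 <= E i0)%MS by rewrite genmxE.
have H2E : (H2 <= E i0)%MS := diffmxSl _ _.
have rv : \rank v = 1%N by rewrite rank_rV vn0.
have capE : (E i0 :&: v :=: v)%MS by apply: capmx_idPr.
have H12 : (E i0 <= H1 + H2)%MS.
  have := addsmx_diff_cap_eq (E i0) v => eqE.
  rewrite -eqE addsmxC; apply: addsmxS; rewrite ?submx_refl //.
  by rewrite genmxE capE.
have r1 : (\rank H1 < \rank (E i0))%N by rewrite genmxE rv.
have r2 : (\rank H2 < \rank (E i0))%N.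
  have := mxrank_cap_compl (E i0) v.
  by rewrite capE rv => <-; rewrite add1n.
pose upd H i := if i == i0 then H else E i.
have step H : (H <= E i0)%MS -> (\rank H < \rank (E i0))%N ->
    (forall J : {set I}, (#|J| <= \rank (\sum_(i in J) upd H i)%MS)%N) ->
    exists phi : I -> 'rV[F]_n,
    (forall i, (phi i <= E i)%MS) /\ (#|I| <= \rank (\sum_i <<phi i>>)%MS)%N.
  move=> HE rH hallH.
  have [|phi [phiE rphi]] := IH (upd H) _ hallH.
    rewrite -ltnS; apply: leq_trans ltm.
    rewrite ltnS (bigD1 i0) //= [X in (_ < X)%N](bigD1 i0) //= /upd eqxx.
    rewrite (eq_bigr (fun i => \rank (E i))) ?ltn_add2r //.
    by move=> i /negbTE->.
  exists phi; split=> // i; apply: submx_trans (phiE i) _.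
  by rewrite /upd; case: eqP => [->|].
have [h1|/existsNP [J1 /negP]] :=
  pselect (forall J : {set I}, (#|J| <= \rank (\sum_(i in J) upd H1 i)%MS)%N).
  exact: step h1.
have [h2|/existsNP [J2 /negP]] :=
  pselect (forall J : {set I}, (#|J| <= \rank (\sum_(i in J) upd H2 i)%MS)%N).
  by move=> _; exact: step h2.
rewrite -!ltnNge.
(* A violating set must contain [i0], since otherwise the replacement does not affect it and the
   hypothesis on [E] applies. *)
have inJ H (J : {set I}) : (\rank (\sum_(i in J) upd H i)%MS < #|J|)%N -> i0 \in J.
  move=> lt; apply: contraLR lt => nJ; rewrite -leqNgt.
  rewrite (eq_bigr E); first exact: hall.
  move=> i iJ; rewrite /upd; case: eqP => // ei.
  by rewrite -ei iJ in nJ.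
move=> lt2 lt1; exfalso; have i1 := inJ _ _ lt1; have i2 := inJ _ _ lt2.
have big H (J : {set I}) : i0 \in J ->
    (\sum_(i in J) upd H i :=: H + \sum_(i in J :\ i0) E i)%MS.
  move=> iJ; rewrite (big_setD1 i0 iJ) /= {1}/upd eqxx.
  rewrite (eq_bigr E); first exact.
  by move=> i; rewrite !inE /upd => /andP [/negbTE->].
rewrite (big _ _ i1) in lt1; rewrite (big _ _ i2) in lt2.
set S1 := (H1 + _)%MS in lt1; set S2 := (H2 + _)%MS in lt2.
have cap : (\sum_(i in (J1 :&: J2) :\ i0) E i <= S1 :&: S2)%MS.
  apply/sumsmx_subP => i; rewrite !inE => /and3P [ni ii1 ii2].
  rewrite sub_capmx; apply/andP; split; apply: submx_trans (addsmxSr _ _);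
  by apply: (sumsmx_sup i); rewrite ?inE ?ni.
have sum : (\sum_(i in J1 :|: J2) E i <= S1 + S2)%MS.
  apply/sumsmx_subP => i; rewrite !inE.
  have [-> _|ni] := eqVneq i i0.
    by apply: submx_trans H12 _; apply: addsmxS; exact: addsmxSl.
  case/orP=> ij; [apply: submx_trans (addsmxSl _ _)|apply: submx_trans (addsmxSr _ _)];
  apply: submx_trans (addsmxSr _ _); by apply: (sumsmx_sup i); rewrite ?inE ?ni.
(* The index [i0] is left out of the intersection, which costs one, while the two strict
   inequalities gain two: a contradiction. *)
have := leq_add (leq_trans (hall _) (mxrankS cap)) (leq_trans (hall _) (mxrankS sum)).
rewrite addnC [X in (_ <= X)%N]addnC mxrank_sum_cap => le.
have c1 : #|J1 :&: J2| = #|(J1 :&: J2) :\ i0|.+1.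
  by rewrite (cardsD1 i0 (J1 :&: J2)) !inE i1 i2.
have := leq_add lt1 lt2; rewrite -cardsUI c1 addSn !addnS ltnS => le2.
by have := leq_ltn_trans le le2; rewrite addnC ltnn.
Qed.

(** * Freeness and spans over [F] of finite families in [L] *)

Section Families.

Variables (F L : fieldType) (f : {rmorphism F -> L}).

(* Finite families of elements of [L] are column vectors, so that a matrix over
   [F] acts on them by taking linear combinations. *)
Local Notation "M ^f" := (map_mx f M) : ring_scope.

Definition free_over k (s : 'cV[L]_k) :=
  forall v : 'rV[F]_k, v^f *m s = 0 -> v = 0.

Definition in_span k (s : 'cV[L]_k) (x : L) :=
  exists v : 'rV[F]_k, x%:M = v^f *m s.

Lemma span_linear k (s : 'cV[L]_k) c x y :
  in_span s x -> in_span s y -> in_span s (f c * x + y).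
Proof.
move=> [u ux] [v vy]; exists (c *: u + v).
by rewrite map_mxD map_mxZ mulmxDl -scalemxAl -ux -vy raddfD /= scale_scalar_mx.
Qed.

Lemma span0 k (s : 'cV[L]_k) : in_span s 0.
Proof. by exists 0; rewrite map_mx0 mul0mx raddf0. Qed.

Lemma span_scale k (s : 'cV[L]_k) c x : in_span s x -> in_span s (f c * x).
Proof. by move=> sx; rewrite -[_ * _]addr0; apply: span_linear => //; exact: span0. Qed.

Lemma span_sum k (s : 'cV[L]_k) (I : finType) (x : I -> L) :
  (forall i, in_span s (x i)) -> in_span s (\sum_i x i).
Proof.
move=> sx; elim/big_ind: _ => //; first exact: span0.
by move=> y z sy sz; rewrite -[y]mul1r -(rmorph1 f); apply: span_linear.
Qed.

Lemma span_combE k (s : 'cV[L]_k) (v : 'rV[F]_k) x :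
  x%:M = v^f *m s <-> x = \sum_i f (v 0 i) * s i 0.
Proof.
split=> [/matrixP /(_ 0 0)|->].
  by rewrite !mxE eqxx mulr1n => ->; apply: eq_bigr => i _; rewrite mxE.
apply/matrixP => i j; rewrite !ord1 !mxE eqxx mulr1n.
by apply: eq_bigr => l _; rewrite mxE.
Qed.

Lemma span_entry k (s : 'cV[L]_k) i : in_span s (s i 0).
Proof.
exists (delta_mx 0 i); rewrite map_delta_mx -rowE.
by apply/matrixP => u v; rewrite !ord1 !mxE eqxx.
Qed.

Lemma span_coords m k (s : 'cV[L]_m) (t : 'cV[L]_k) :
  (forall i, in_span t (s i 0)) -> exists P : 'M[F]_(m, k), s = P^f *m t.
Proof.
move=> /fin_all_exists [v vP]; exists (\matrix_i v i).
apply/row_matrixP => i; rewrite row_mul -map_row rowK -vP.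
by apply/matrixP => u w; rewrite !ord1 !mxE eqxx.
Qed.

Lemma span_mul m k (t : 'cV[L]_k) (P : 'M[F]_(m, k)) x :
  in_span (P^f *m t) x <->
    exists v : 'rV_k, (v <= P)%MS /\ x%:M = v^f *m t.
Proof.
split=> [[v xv]|[v [/submxP [u ->] xu]]].
  by exists (v *m P); rewrite submxMl xv map_mxM mulmxA.
by exists u; rewrite xu map_mxM mulmxA.
Qed.

Lemma free_row_free m k (t : 'cV[L]_k) (P : 'M[F]_(m, k)) :
  free_over (P^f *m t) -> row_free P.
Proof.
move=> fr; apply: inj_row_free => v vP; apply: fr.
by rewrite mulmxA -map_mxM vP map_mx0 mul0mx.
Qed.

Lemma row_free_free m k (t : 'cV[L]_k) (P : 'M[F]_(m, k)) :
  free_over t -> row_free P -> free_over (P^f *m t).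
Proof.
move=> fr rP v; rewrite mulmxA -map_mxM => /fr /eqP.
by rewrite mulmx_free_eq0 // => /eqP.
Qed.

Lemma free_coords_uniq k (t : 'cV[L]_k) (u v : 'rV[F]_k) :
  free_over t -> u^f *m t = v^f *m t -> u = v.
Proof.
move=> fr uv; apply/eqP; rewrite -subr_eq0; apply/eqP/fr.
by rewrite map_mxB mulmxBl uv subrr.
Qed.

Lemma free_scale k (t : 'cV[L]_k) e : e != 0 -> free_over t -> free_over (e *: t).
Proof.
by move=> e0 fr v; rewrite -scalemxAr => /eqP; rewrite scaler_eq0 (negbTE e0) => /eqP /fr.
Qed.

Lemma free_entry k (t : 'cV[L]_k) i : free_over t -> t i 0 != 0.
Proof.
move=> fr; apply/eqP => t0; have /fr : (delta_mx 0 i : 'rV[F]_k)^f *m t = 0.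
  by rewrite map_delta_mx -rowE; apply/matrixP => u v; rewrite !ord1 !mxE.
by move/matrixP/(_ 0 i); rewrite !mxE !eqxx => /eqP; rewrite oner_eq0.
Qed.

Lemma free_size_le m k (s : 'cV[L]_m) (t : 'cV[L]_k) :
  free_over s -> (forall i, in_span t (s i 0)) -> (m <= k)%N.
Proof.
move=> fs /span_coords [P sP]; rewrite sP in fs.
by have /eqP <- := free_row_free fs; exact: rank_leq_col.
Qed.

(** The coordinate matrix of [s] over [t] is square and row free, hence invertible. *)
Lemma free_span_eq m (s t : 'cV[L]_m) x :
  free_over s -> (forall i, in_span t (s i 0)) -> in_span t x -> in_span s x.
Proof.
move=> fs /span_coords [P sP]; rewrite sP in fs *.
have := free_row_free fs; rewrite row_free_unit => uP [v xv].
by exists (v *m invmx P); rewrite xv mulmxA -map_mxM mulmxKV.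
Qed.

Lemma subspace_basis k (t : 'cV[L]_k) (Q : L -> Prop) :
  free_over t -> Q 0 -> (forall c x y, Q x -> Q y -> Q (f c * x + y)) ->
  (forall x, Q x -> in_span t x) ->
  exists m (s : 'cV[L]_m), free_over s /\ (forall x, Q x <-> in_span s x).
Proof.
move=> fr Q0 Qlin Qt.
pose P (v : 'rV[F]_k) := Q ((v^f *m t) 0 0).
have [||M MP] := @linear_pred_rowspace _ _ P.
- by rewrite /P map_mx0 mul0mx mxE.
- move=> c u v; rewrite /P map_mxD map_mxZ mulmxDl -scalemxAl => Pu Pv.
  by rewrite [X in Q X]mxE [X in Q (X + _)]mxE; apply: Qlin.
exists (\rank M), ((row_base M)^f *m t).
split; first by apply: row_free_free; rewrite ?row_base_free.
move=> x; rewrite span_mul; split=> [Qx|[v [vM xv]]].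
  have [v xv] := Qt _ Qx; exists v; split=> //.
  by rewrite eq_row_base; apply/MP; rewrite /P -xv mxE eqxx mulr1n.
rewrite eq_row_base in vM; move/MP: vM.
by rewrite /P -xv mxE eqxx mulr1n.
Qed.

(** * The Dyson transform and the Chowla-type bound *)

(** The new spaces are S + eT and T ∩ e^-1 S. Both S and eT lie in A, so in coordinates over [a]
    they are row spaces [P] and [Q], and the dimension count is the modular law for [P] and [Q]. *)
Lemma dyson_transform n j k (a : 'cV[L]_n) (s : 'cV[L]_j) (t : 'cV[L]_k) e :
  free_over a -> free_over s -> free_over t -> in_span t 1 ->
  (forall x y, in_span s x -> in_span t y -> in_span a (x * y)) ->
  in_span s e -> (exists y, in_span t y /\ ~ in_span s (e * y)) ->
  exists j' k' (s' : 'cV[L]_j') (t' : 'cV[L]_k'),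
    [/\ free_over s', free_over t', in_span t' 1,
       forall x y, in_span s' x -> in_span t' y -> in_span a (x * y) &
       (forall y, in_span t' y -> in_span t y)
         /\ (k' < k /\ j' + k' = j + k)%N].
Proof.
move=> fa fs ft t1 st_a se [y0 [ty0 nsy0]].
have e0 : e != 0.
  by apply/eqP => e0; apply: nsy0; rewrite e0 mul0r; exact: span0.
have sa x : in_span s x -> in_span a x.
  by move=> sx; rewrite -[x]mulr1; exact: st_a.
have [P sP] : exists P : 'M_(j, n), s = P^f *m a.
  by apply: span_coords => i; apply: sa; exact: span_entry.
have [Q eQ] : exists Q : 'M_(k, n), e *: t = Q^f *m a.
  by apply: span_coords => i; rewrite mxE; apply: st_a => //; exact: span_entry.
have rP : row_free P by apply: (@free_row_free _ _ a); rewrite -sP.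
have rQ : row_free Q.
  by apply: (@free_row_free _ _ a); rewrite -eQ; exact: free_scale.
(* Rows of [R] are the coordinates over [t] of elements that generate T ∩ e^-1 S: multiplication by
   e has matrix [Q], and [R *m Q] is [P :&: Q]. *)
pose R := ((P :&: Q) *m pinvmx Q)%MS.
have RQ : R *m Q = (P :&: Q)%MS by rewrite /R mulmxKpV ?capmxSr.
have rR : \rank R = \rank (P :&: Q)%MS by rewrite -RQ mxrankMfree.
have coordQ (v : 'rV_k) x : x%:M = v^f *m t -> (e * x)%:M = (v *m Q)^f *m a.
  by move=> xv; rewrite map_mxM -mulmxA -eQ -scalemxAr -xv -scale_scalar_mx.
have spanR y : in_span ((row_base R)^f *m t) y <-> in_span t y /\ in_span s (e * y).
  rewrite span_mul; split=> [[v [vR yv]]|[[v yv] sey]].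
    split; first by exists v.
    rewrite sP span_mul; exists (v *m Q); split; last exact: coordQ.
    rewrite eq_row_base in vR.
    by apply: submx_trans (submxMr Q vR) _; rewrite RQ capmxSl.
  exists v; split=> //; rewrite eq_row_base.
  move: sey; rewrite sP span_mul (coordQ _ _ yv) => -[w [wP /(free_coords_uniq fa) eqw]].
  have : (v *m Q <= R *m Q)%MS by rewrite RQ sub_capmx submxMl eqw wP.
  by rewrite submxMfree.
exists (\rank (P + Q)%MS), (\rank R), ((row_base (P + Q)%MS)^f *m a),
  ((row_base R)^f *m t); split.
- by apply: row_free_free; rewrite ?row_base_free.
- by apply: row_free_free; rewrite ?row_base_free.
- by apply/spanR; rewrite mulr1.
- move=> x y; rewrite span_mul => -[v []]; rewrite eq_row_base.
  case/sub_addsmxP=> -[u1 u2] /= -> xE /spanR [ty sey].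
  (* Write x = x1 + e y1 with x1 in S and y1 in T. Then xy = x1 y + (e y) y1, and e y lies in S, so
     both terms lie in ST. *)
  have -> : x = ((u1 *m P)^f *m a) 0 0 + e * (u2^f *m t) 0 0.
    have : x%:M = (u1 *m P)^f *m a + e *: (u2^f *m t).
      by rewrite xE map_mxD mulmxDl (map_mxM f u2) -(mulmxA u2^f) -eQ -scalemxAr.
    by move/matrixP/(_ 0 0); rewrite mxE eqxx mulr1n => ->;
      rewrite [LHS]mxE [X in _ + X]mxE.
  rewrite mulrDl -[X in X + _]mul1r -(rmorph1 f); apply: span_linear.
    apply: st_a => //; exists u1; rewrite -mx11_scalar sP map_mxM mulmxA //.
  rewrite mulrAC; apply: st_a => //; exists u2; by rewrite -mx11_scalar.
- split=> [y /spanR []//|]; split; last first.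
    rewrite rR mxrank_sum_cap; move/eqP: rP => ->; by move/eqP: rQ => ->.
  rewrite ltn_neqAle rR; apply/andP; split; last first.
    by apply: leq_trans (mxrankS (capmxSr P Q)) _; exact: rank_leq_row.
  (* Equal ranks would give eT ⊂ S, contrary to the choice of [y0]. *)
  apply/negP => /eqP rk; apply: nsy0.
  have : (Q <= P :&: Q)%MS.
    have /mxrank_leqif_sup [_ <-] := capmxSr P Q.
    by rewrite rk; move/eqP: rQ => ->.
  rewrite sub_capmx => /andP [QP _].
  case: ty0 => v /coordQ yv; rewrite sP span_mul; exists (v *m Q); split=> //.
  exact: submx_trans (submxMl _ _) QP.
Qed.

(** Dyson transforms lower dim T, so they stop at a pair with ST ⊂ S. The sum of dimensions is
    preserved and dim S is at most [n], so T still has dimension at least 2 and contains some b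
    outside F; then every b^m x with x in S stays in S, inside A. *)
Lemma chowla_stable n j k (a : 'cV[L]_n) (s : 'cV[L]_j) (t : 'cV[L]_k) :
  free_over a -> free_over s -> free_over t -> in_span t 1 -> (0 < j)%N ->
  (forall x y, in_span s x -> in_span t y -> in_span a (x * y)) ->
  (n.+2 <= j + k)%N ->
  exists x b, [/\ x != 0, in_span t b, (forall c, b <> f c) &
                  forall m, in_span a (b ^+ m * x)].
Proof.
have [K ltK] := ubnP k; elim: K j k s t ltK => // K IH j k s t ltK.
move=> fa fs ft t1 j0 st_a le.
have sa x : in_span s x -> in_span a x.
  by move=> sx; rewrite -[x]mulr1; exact: st_a.
have [[e [y [se ty nsy]]]|stab] :=
  pselect (exists e y, [/\ in_span s e, in_span t y & ~ in_span s (e * y)]).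
  have [|j' [k' [s' [t' [fs' ft' t1' st' [sub [lt eqjk]]]]]]] :=
    @dyson_transform _ _ _ a s t e fa fs ft t1 st_a se; first by exists y.
  have [|||x [b [x0 tb bF bx]]] := IH _ _ s' t' _ fa fs' ft' t1' _ st'.
  - exact: leq_trans lt _.
  - by rewrite -(ltn_add2r k') eqjk (leq_trans lt) ?leq_addl.
  - by rewrite eqjk.
  by exists x, b; split=> //; apply: sub.
have jn : (j <= n)%N by apply: (@free_size_le _ _ s a) => // i; apply/sa/span_entry.
have k1 : (1 < k)%N.
  by rewrite ltnNge; apply/negP => k1; have := leq_trans le (leq_add jn k1);
    rewrite addn1 ltnn.
have [b [tb bF]] : exists b, in_span t b /\ forall c, b <> f c.
  apply: contrapT => nb.
  have : (k <= 1)%N.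
    apply: (@free_size_le _ _ t (1%:M)) => // i.
    have : ~ (forall c, t i 0 <> f c).
      by move=> ti; apply: nb; exists (t i 0); split=> //; exact: span_entry.
    by case/existsNP => c /contrapT ->; exists c%:M; rewrite mulmx1 map_scalar_mx.
  by rewrite leqNgt k1.
exists (s (Ordinal j0) 0), b; split=> //; first exact: free_entry.
move=> m; apply: sa; elim: m => [|m IHm]; first by rewrite mul1r; exact: span_entry.
rewrite exprS -mulrA mulrC; apply: contrapT => nsm; apply: stab.
by exists (b ^+ m * s (Ordinal j0) 0), b.
Qed.

Lemma span_bilinear n j k (a : 'cV[L]_n) (s : 'cV[L]_j) (t : 'cV[L]_k) x y :
  (forall i l, in_span a (s i 0 * t l 0)) ->
  in_span s x -> in_span t y -> in_span a (x * y).
Proof.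
move=> st [u /span_combE ->] [v /span_combE ->].
rewrite mulr_suml; apply: span_sum => i; rewrite mulr_sumr; apply: span_sum => l.
by rewrite mulrACA -rmorphM; apply: span_scale.
Qed.

Lemma span_scalel k (s : 'cV[L]_k) e x : in_span s x -> in_span (e *: s) (e * x).
Proof. by case=> v xv; exists v; rewrite -scalemxAr -xv scale_scalar_mx. Qed.

Lemma span_scalelV k (s : 'cV[L]_k) e x :
  in_span (e *: s) x -> exists y, in_span s y /\ x = e * y.
Proof.
case=> v xv; exists ((v^f *m s) 0 0); split; first by exists v; rewrite -mx11_scalar.
by move/matrixP/(_ 0 0): xv; rewrite -scalemxAr mxE eqxx mulr1n mxE.
Qed.

(** * The ring F[b] and its inverses *)

(** The ring F[b], as the values at [b] of polynomials over [F]; inverses come only once it has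
    finite dimension. *)
Definition adjoin (b y : L) := exists p : {poly F}, y = (map_poly f p).[b].

Lemma adjoin_in_span n (a : 'cV[L]_n) x b y :
  (forall m, in_span a (b ^+ m * x)) -> adjoin b y -> in_span a (y * x).
Proof.
move=> bx [p ->]; rewrite horner_coef mulr_suml; apply: span_sum => i.
by rewrite coef_map /= -mulrA; apply: span_scale.
Qed.

Lemma adjoinC b c : adjoin b (f c).
Proof. by exists c%:P; rewrite map_polyC hornerC. Qed.

Lemma adjoinX b : adjoin b b.
Proof. by exists 'X; rewrite map_polyX hornerX. Qed.

Lemma adjoinB b y z : adjoin b y -> adjoin b z -> adjoin b (y - z).
Proof. by move=> [p ->] [q ->]; exists (p - q); rewrite rmorphB hornerD hornerN. Qed.

Lemma adjoinM b y z : adjoin b y -> adjoin b z -> adjoin b (y * z).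
Proof. by move=> [p ->] [q ->]; exists (p * q); rewrite rmorphM hornerM. Qed.

Lemma adjoin_linear b c y z : adjoin b y -> adjoin b z -> adjoin b (f c * y + z).
Proof.
move=> by_ bz; rewrite -[z]opprK; apply: adjoinB; first exact: adjoinM (adjoinC _ _) _.
by rewrite -[- z]add0r -(rmorph0 f); apply: adjoinB => //; exact: adjoinC.
Qed.

(** F[b] embeds in x^-1 A, which bounds its dimension by [n] and forces equality with x^-1 A when
    the dimensions agree. Multiplication by a nonzero y is injective on F[b], hence surjective, so
    it attains 1. *)
Lemma adjoin_field n (a : 'cV[L]_n) x b :
  free_over a -> x != 0 -> (forall m, in_span a (b ^+ m * x)) ->
  exists m (s : 'cV[L]_m),
    [/\ (m <= n)%N, free_over s, forall y, adjoin b y <-> in_span s y,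
        forall y, adjoin b y -> adjoin b y^-1 &
        m = n -> forall z, in_span a z -> adjoin b (x^-1 * z)].
Proof.
move=> fa x0 bx.
have fxa : free_over (x^-1 *: a) by apply: free_scale; rewrite ?invr_eq0.
have adj_xa y : adjoin b y -> in_span (x^-1 *: a) y.
  move=> /(adjoin_in_span bx) yx; rewrite -[y](mulfK x0) mulrC.
  exact: span_scalel.
have [||m [s [fs sM]]] := @subspace_basis _ _ (adjoin b) fxa _ _ adj_xa.
- by rewrite -(rmorph0 f); exact: adjoinC.
- by move=> c y z; exact: adjoin_linear.
have sxa i : in_span (x^-1 *: a) (s i 0) by apply/adj_xa/sM/span_entry.
exists m, s; split=> //.
- exact: free_size_le sxa.
- move=> y My; have [->|y0] := eqVneq y 0.
    by rewrite invr0 -(rmorph0 f); exact: adjoinC.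
  have : in_span (y *: s) 1.
    apply: (@free_span_eq _ _ s); first exact: free_scale.
      by move=> i; rewrite mxE; apply/sM/adjoinM => //; apply/sM/span_entry.
    by apply/sM; rewrite -(rmorph1 f); exact: adjoinC.
  case/span_scalelV=> z [/sM Mz yz].
  by have -> : y^-1 = z by rewrite -[y^-1]mulr1 yz mulKf.
- move=> mn z az; subst m; apply/sM.
  by apply: (free_span_eq fs sxa); exact: span_scalel.
Qed.

(** * Matchings and the obstruction to them *)

(** Rado's theorem is applied to the annihilators of the [U i]; the transversal found there supplies
    the columns of [D]. *)
Lemma dual_transversal n (U : 'I_n -> 'M[F]_n) :
  (forall (J : {set 'I_n}) (Y : 'M_n), J != set0 ->
    (forall i, i \in J -> (Y <= U i)%MS) -> (\rank Y + #|J| <= n)%N) ->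
  exists D : 'M[F]_n, D \in unitmx /\
    forall i (v : 'rV_n), (v <= U i)%MS -> (v *m D) 0 i = 0.
Proof.
move=> hall.
have [J|phi [phiE rphi]] := @rado_rowspaces F _ n (fun i => (cokermx (U i))^T).
  have [->|J0] := eqVneq J set0; first by rewrite cards0.
  set S := (\sum_(i in J) _)%MS.
  (* The common kernel of the annihilators indexed by [J] lies in every [U i] and has rank n - rank
     S, so the hypothesis on it is Hall's condition. *)
  have := hall J (kermx S^T) J0; rewrite mxrank_ker mxrank_tr => le.
  rewrite -(leq_add2l (n - \rank S)) subnK ?rank_leq_row //; apply: le => i iJ.
  have /submxP [W WE] : ((cokermx (U i))^T <= S)%MS by apply: (sumsmx_sup i).
  rewrite submxE -[cokermx _]trmxK WE trmx_mul mulmxA.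
  suff -> : kermx S^T *m S^T = 0 by rewrite mul0mx.
  exact/sub_kermxP.
exists (\matrix_i phi i)^T; split.
  rewrite unitmx_tr -row_free_unit /row_free eqn_leq rank_leq_row.
  rewrite card_ord in rphi; apply: leq_trans rphi _; apply: mxrankS.
  by apply/sumsmx_subP => i _; rewrite genmxE -[phi i](@rowK _ _ _ phi) row_sub.
move=> i v vU; have /submxP [w wE] := phiE i.
have -> : (v *m (\matrix_i phi i)^T) 0 i = (v *m (phi i)^T) 0 0.
  by rewrite !mxE; apply: eq_bigr => l _; rewrite !mxE.
rewrite wE trmx_mul trmxK mulmxA; move: vU; rewrite submxE => /eqP ->.
by rewrite mul0mx mxE.
Qed.

(* If [Y] violates Hall's condition for [J], the spans of [(a_i)_(i in J)] and
   of [1] and [Y] have their product in [A] but their dimensions sum to at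
   least [n + 2], contrary to the Chowla-type bound. *)
Lemma matching_or_stable n (a b : 'cV[L]_n) :
  free_over a -> free_over b -> ~ in_span b 1 ->
  (exists D : 'M[F]_n, D \in unitmx /\
    forall i (v : 'rV[F]_n), in_span a (a i 0 * (v^f *m b) 0 0) -> (v *m D) 0 i = 0)
  \/ (exists x c u, [/\ x != 0, in_span b u, u != 0 &
        (forall d, f c + u <> f d) /\
        forall m, in_span a ((f c + u) ^+ m * x)]).
Proof.
move=> fa fb nb1.
(* [U i] is a_i^-1 A ∩ B in coordinates over [b]. *)
have Uex i : exists U : 'M[F]_n, forall v : 'rV[F]_n,
    in_span a (a i 0 * (v^f *m b) 0 0) <-> (v <= U)%MS.
  apply: linear_pred_rowspace => [|c u v iu iv].
    by rewrite map_mx0 mul0mx mxE mulr0; exact: span0.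
  rewrite map_mxD map_mxZ mulmxDl -scalemxAl mxE [X in X + _]mxE mulrDr mulrCA.
  exact: span_linear.
have {Uex} [U UP] := fin_all_exists Uex.
have [tr|no] := pselect (exists D : 'M[F]_n, D \in unitmx /\
    forall i (v : 'rV_n), (v <= U i)%MS -> (v *m D) 0 i = 0).
  by left; case: tr => D [uD DU]; exists D; split=> // i v /UP; exact: DU.
right; have : ~ forall (J : {set 'I_n}) (Y : 'M_n), J != set0 ->
    (forall i, i \in J -> (Y <= U i)%MS) -> (\rank Y + #|J| <= n)%N.
  by move=> /dual_transversal.
case/existsNP=> J /existsNP [Y] /not_implyP [J0] /not_implyP [YU] /negP.
rewrite -ltnNge => lt.
pose g (i : 'I_#|J|) : 'I_n := enum_val i.
pose P : 'M[F]_(#|J|, n) := rowsub g 1%:M.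
have fP : row_free P.
  apply/row_freeP; exists (colsub g 1%:M); rewrite -rowsubE.
  by apply/matrixP => i l; rewrite !mxE (inj_eq enum_val_inj).
pose s := P^f *m a; pose u := (row_base Y)^f *m b.
have sE i : s i 0 = a (g i) 0.
  by rewrite /s /P map_mxsub map_mx1 -rowsubE mxE.
(* T is spanned by 1 and Y; it is free because 1 is not in B. *)
pose t := col_mx (1%:M : 'cV[L]_1) u.
have uB y : in_span u y -> in_span b y.
  by rewrite span_mul => -[v [_ ?]]; exists v.
have ft : free_over t.
  move=> v; rewrite -[v]hsubmxK map_row_mx mul_row_col mulmx1.
  set v1 := lsubmx v; set v2 := rsubmx v => eq0.
  have v10 : v1 = 0.
    apply: contrapT => /eqP nz; apply: nb1.
    have c0 : v1 0 0 != 0 by apply: contraNneq nz => c0;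
      rewrite [v1]mx11_scalar c0 raddf0.
    apply: uB; exists ((- (v1 0 0)^-1) *: v2).
    rewrite map_mxZ -scalemxAl rmorphN scaleNr.
    have -> : v2^f *m u = - v1^f by apply/eqP; rewrite -addr_eq0 addrC eq0.
    rewrite scalerN opprK [v1]mx11_scalar map_scalar_mx scale_scalar_mx.
    by rewrite mxE eqxx mulr1n -rmorphM mulVf ?rmorph1.
  have -> : v2 = 0.
    have fu : free_over u by apply: row_free_free; rewrite ?row_base_free.
    by apply: fu; rewrite -eq0 v10 map_mx0 add0r.
  by rewrite v10 row_mx0.
have t1 : in_span t 1.
  have := span_entry t (lshift _ 0); by rewrite col_mxEu mxE.
have st_a x y : in_span s x -> in_span t y -> in_span a (x * y).
  apply: span_bilinear => i l; rewrite sE -[l]splitK.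
  case: (fintype.split l) => l' /=; rewrite ?col_mxEu ?col_mxEd.
    by rewrite ord1 mxE eqxx mulr1; exact: span_entry.
  have -> : u l' 0 = ((row l' (row_base Y))^f *m b) 0 0.
    by rewrite !mxE; apply: eq_bigr => m _; rewrite !mxE.
  apply/UP; apply: submx_trans (row_sub _ _) _; rewrite eq_row_base.
  by apply: YU; exact: enum_valP.
have [|||x [d [x0 td dF dx]]] := chowla_stable fa _ ft t1 _ st_a.
- exact: row_free_free.
- by rewrite card_gt0.
(* The extra vector 1 turns |J| + dim Y > n into a sum of dimensions of at least n + 2. *)
- by rewrite addnCA add1n addnC.
have [c [w [wB dE]]] : exists c w, in_span u w /\ d = f c + w.
  case: td => v; rewrite -[v]hsubmxK map_row_mx mul_row_col mulmx1.
  set v1 := lsubmx v; set v2 := rsubmx v => /matrixP /(_ 0 0).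
  rewrite mxE eqxx mulr1n [in RHS]mxE [X in X + _]mxE => ->.
  by exists (v1 0 0), ((v2^f *m u) 0 0); split=> //; exists v2; rewrite -mx11_scalar.
exists x, c, w; rewrite -dE; split=> //; first exact: uB.
by apply/eqP => w0; apply: (dF c); rewrite dE w0 addr0.
Qed.

(** * Translation between predicates over K and families over [F] *)

Section Predicates.

Variables (K : L -> Prop) (KE : forall x, K x <-> exists c, x = f c).

Lemma span_ofE k (v : 'I_k -> L) x :
  span_of K predT v x <-> in_span (\col_i v i) x.
Proof.
split=> [[c [cK ->]]|[w /span_combE ->]].
  apply: span_sum => i; have /KE [d ->] := cK i; apply: span_scale.
  by have := span_entry (\col_i v i) i; rewrite mxE.
exists (fun i => f (w 0 i)); split=> [i|]; first by apply/KE; exists (w 0 i).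
by apply: eq_bigr => i _; rewrite mxE.
Qed.

Lemma linindepE k (v : 'I_k -> L) : linindep K v <-> free_over (\col_i v i).
Proof.
split=> [li w w0|fr c cK c0 i].
  apply/rowP => i; rewrite mxE; apply: (fmorph_inj f); rewrite rmorph0.
  apply: (li (fun i => f (w 0 i))) => [l|]; first by apply/KE; exists (w 0 l).
  apply/esym; rewrite -(rmorph0 (@scalar_mx L 1)) in w0.
  by move/esym/span_combE: w0 => w0; rewrite [LHS]w0; apply: eq_bigr => l _; rewrite mxE.
have [d dE] := fin_all_exists (fun l => proj1 (KE (c l)) (cK l)).
have /rowP /(_ i) : \row_i d i = 0.
  apply: fr; rewrite -(rmorph0 (@scalar_mx L 1)); apply/esym/span_combE.
  by rewrite -[LHS]c0; apply: eq_bigr => l _; rewrite dE !mxE.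
by rewrite dE !mxE => ->; rewrite rmorph0.
Qed.

Lemma linindep_entries k (s : 'cV[L]_k) :
  linindep K (fun i => s i 0) <-> free_over s.
Proof.
rewrite linindepE; suff -> : \col_i s i 0 = s by [].
by apply/colP => i; rewrite mxE.
Qed.

Lemma span_of_entries k (s : 'cV[L]_k) x :
  span_of K predT (fun i => s i 0) x <-> in_span s x.
Proof.
rewrite span_ofE; suff -> : \col_i s i 0 = s by [].
by apply/colP => i; rewrite mxE.
Qed.

End Predicates.

End Families.

(** * The subfield K as a field type *)

Section SubfieldType.

Variables (L : fieldType) (K : L -> Prop) (hK : is_subfield K).

Definition subfield_pred : {pred L} := fun x => `[< K x >].

Lemma subfield_pred_divring : divring_closed subfield_pred.
Proof.
case: hK => _ [K1 [KB [KM KV]]].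
split=> [|x y|x y]; rewrite /in_mem /=; first exact/asboolP.
  by move=> /asboolP Kx /asboolP Ky; apply/asboolP/KB.
by move=> /asboolP Kx /asboolP Ky; apply/asboolP/KM => //; exact: KV.
Qed.

HB.instance Definition _ :=
  GRing.isDivringClosed.Build L subfield_pred subfield_pred_divring.

Record subfield_type :=
  SubfieldType { subfield_val : L; _ : subfield_val \in subfield_pred }.

HB.instance Definition _ := [isSub for subfield_val].
HB.instance Definition _ := [Choice of subfield_type by <:].
HB.instance Definition _ := [SubChoice_isSubIntegralDomain of subfield_type by <:].
HB.instance Definition _ := [SubIntegralDomain_isSubField of subfield_type by <:].

(** Matrices need scalars in a field type, so the predicate K is replaced by a field with an
    embedding whose image is K. *)
Lemma subfield_embedding :
  exists (F : fieldType) (f : {rmorphism F -> L}), forall x, K x <-> exists c, x = f c.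
Proof.
exists subfield_type, (val : {rmorphism subfield_type -> L}) => x.
split=> [Kx|[c ->]]; last exact/asboolP/(valP c).
by exists (SubfieldType (introT (asboolP _) Kx : x \in subfield_pred)).
Qed.

End SubfieldType.

(** * Matching under each of the three conditions *)

Theorem theorem1p8 (L : fieldType) (K : L -> Prop) (n : nat) (A B : L -> Prop) :
  is_subfield K ->
  dim_subspace K A n -> dim_subspace K B n ->
  ~ B 1 -> (1 < n)%N ->
  ( ( (forall M : L -> Prop, intermediate_field K M -> (exists x, ~ M x) ->
         (exists d, dim_subspace K M d) ->
         forall x, B x -> M x -> x = 0) /\
      ((n <= 5)%N \/ (forall x, algebraic_over K x -> separable_over K x)) )
    \/ (p_eq K n /\ ~ translate_of_proper_intermediate K A)
    \/ sidon K A ) ->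
  matched K A B n.
Proof.
move=> hK _ [_ [b0 [b0free b0B]]] nB1 _ hyp a0 [a0free a0A].
have [F [f KE]] := subfield_embedding hK.
pose a := \col_i a0 i; pose b := \col_i b0 i.
have fa : free_over f a by apply/(linindepE KE).
have fb : free_over f b by apply/(linindepE KE).
have Aa x : A x <-> in_span f a x by rewrite a0A (span_ofE KE).
have Bb x : B x <-> in_span f b x by rewrite b0B (span_ofE KE).
have nb1 : ~ in_span f b 1 by move=> /Bb.
have [[D [uD DP]]|[x [c [u [x0 bu u0 [dF dx]]]]]] := matching_or_stable fa fb nb1.
  (* Coordinates over [b'] are those over [b] multiplied by [D], so the vanishing of the i-th entry
     of [v *m D] is exactly the matching condition. *)
  pose b' := map_mx f (invmx D) *m b.
  have b'E v : map_mx f v *m b = map_mx f (v *m D) *m b' :> 'M_1.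
    by rewrite mulmxA -map_mxM mulmxK.
  exists (fun i => b' i 0); split.
    split; first apply/(linindep_entries KE)/row_free_free => //.
      by rewrite row_free_unit unitmx_inv.
    move=> y; rewrite Bb (span_of_entries KE); split=> [[v yv]|].
      by exists (v *m D); rewrite -b'E.
    by rewrite span_mul => -[v [_ yv]]; exists v.
  move=> i y [z [Az ->]] /Bb [v yv].
  have vD0 : (v *m D) 0 i = 0.
    apply: DP; rewrite -yv mxE mxE eqxx mulr1n mulVKf; first exact/Aa.
    by have := free_entry i fa; rewrite mxE.
  exists (fun j => f ((v *m D) 0 j)); split=> [j|].
    by apply/KE; exists ((v *m D) 0 j).
  rewrite b'E in yv; move/span_combE: yv => ->.
  by rewrite (bigD1 i) //= vD0 rmorph0 mul0r add0r.
exfalso; set d := f c + u in dF dx.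
(* If A = L, the [n] free elements of [b] would span A, hence 1 would lie in B. *)
have notall : ~ forall z, in_span f a z.
  move=> az; apply: nb1; apply: (free_span_eq fb) (az 1) => i; exact: az.
(* If F[d] = L, then L = Lx would lie in A. *)
have notM : exists z, ~ adjoin f d z.
  apply: contrapT => /forallNP nM; apply: notall => z.
  rewrite -[z](divfK x0); apply: adjoin_in_span dx _; exact: contrapT (nM _).
have Md : adjoin f d d := adjoinX f d.
have nKd : ~ K d by move=> /KE [e]; exact: dF.
have [m [s [lemn fs sM MV eqmn]]] := adjoin_field fa x0 dx.
have [_ [K1 _]] := hK.
have KM y : K y -> adjoin f d y by move=> /KE [e ->]; exact: adjoinC.
have M0 : adjoin f d 0 by rewrite -(rmorph0 f); exact: adjoinC.
have interM : intermediate_field K (adjoin f d).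
  split=> //; split=> //; split; first exact: KM.
  by split; [exact: adjoinB | split; [exact: adjoinM | exact: MV]].
have dimM : dim_subspace K (adjoin f d) m.
  split.
    split=> //; split=> [y z My Mz|e y /KM Me My]; last exact: adjoinM.
    by rewrite -[y]mul1r -(rmorph1 f); exact: adjoin_linear.
  exists (fun i => s i 0); split; first exact/(linindep_entries KE).
  by move=> y; rewrite (span_of_entries KE).
case: hyp => [[h1 _]|[[[_ pmin] ntr]|sid]].
- suff u00 : u = 0 by rewrite u00 eqxx in u0.
  apply: (h1 _ interM notM); [by exists m | exact/Bb |].
  have -> : u = d - f c by rewrite /d addrC addKr.
  by apply: adjoinB => //; exact: adjoinC.
(* F[d] contains d outside K, so minimality of p(K,L) gives n ≤ m; equality makes A the translate x
   F[d]. *)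
- have mn : m = n.
    apply/eqP; rewrite eqn_leq lemn; apply: pmin interM _ dimM; by exists d.
  apply: ntr; exists x, (adjoin f d); split=> //; split=> //; split; first by exists d.
  split=> // y; split=> [/Aa ay|[z [Mz ->]]].
    by exists (x^-1 * y); split; [exact: eqmn | rewrite mulVKf].
  by apply/Aa; rewrite mulrC; exact: adjoin_in_span Mz.
- clearbody d.
  have d0 : d != 0 by apply/eqP => d0; apply: (dF 0); rewrite rmorph0.
  (* The two vectors are x d and x d^2; exponents start at 1 so that each is d times an element of
     A. *)
  apply: (sid d nKd (fun i : 'I_2 => d ^+ i.+1 * x)).
    move=> i; split; first exact/Aa/dx.
    by exists (d ^+ i * x); split; [exact/Aa/dx | rewrite exprS mulrA].
  move=> e eK; rewrite !big_ord_recl big_ord0 addr0 /= => /eqP.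
  set e0 := e ord0; set e1 := e (lift ord0 ord0).
  have -> : e0 * (d ^+ 1 * x) + e1 * (d ^+ 2 * x) = (e0 + e1 * d) * (d * x).
    by rewrite expr1 expr2 mulrDl !mulrA.
  rewrite !mulf_eq0 (negbTE d0) (negbTE x0) !orbF addr_eq0 => /eqP e01.
  have [_ [_ [KB [KMul KV]]]] := hK.
  have e10 : e1 = 0.
    apply: contrapT => /eqP e1n; apply: nKd.
    (* A relation with e1 nonzero would give d = -e0/e1 in K; the opposite is written as a
       difference, the closure property that [is_subfield] provides. *)
    have -> : d = (0 - e0) * e1^-1 by rewrite sub0r e01 opprK mulrAC mulfV // mul1r.
    apply: KMul; last exact/KV/eK.
    by apply: KB; [case: hK | exact: eK].
  move=> i; case: (unliftP ord0 i) => [j ->|->]; last by rewrite -/e0 e01 e10 mul0r oppr0.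
  by rewrite ord1.
Qed.
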